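(* Let $p$ be an odd prime and let $G_{g\,\mathsf{ANY},\,h\,\mathsf{ANY}}(p)$ denote the number of integers $h$ with $1\le h\le p-1$ for which there exists an integer $g$ with $1\le g\le p-1$ and $g^{h}\equiv h\pmod p$. Then \[ \left|G_{g\,\mathsf{ANY},\,h\,\mathsf{ANY}}(p)-\sum_{e\mid p-1}\frac{1}{e}\,\phi\!\left(\frac{p-1}{e}\right)\right|\le d(p-1)^{2}\sqrt{p}\,(1+\ln p). \]
   Context: $\phi$ is Euler's totient function, $d(n)$ denotes the number of positive divisors of $n$, the sum runs over positive divisors $e$ of $p-1$, and $\ln$ is the natural logarithm. *)

(* Defs.v *)
From mathcomp Require Import all_boot all_order all_algebra.
From mathcomp Require Import all_classical all_reals all_analysis.
Set Implicit Arguments. Unset Strict Implicit. Unset Printing Implicit Defensive.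

Definition G_any_any (p : nat) : nat :=
  #|[set h : 'I_p | (0 < h) && [exists g : 'I_p, (0 < g) && (g ^ h == h %[mod p])]]|.

Definition ndiv (n : nat) : nat := size (divisors n).

(* Main.v *)
Require Import Defs.
From mathcomp Require Import all_boot all_order all_algebra.
From mathcomp Require Import all_fingroup all_solvable all_field.
From mathcomp Require Import all_classical all_reals all_analysis.
From mathcomp Require Import zify ring lra.
Import Order.TTheory GRing.Theory Num.Theory.
Import numFieldNormedType.Exports.
Local Open Scope ring_scope.
Set Implicit Arguments.
Unset Strict Implicit.
Unset Printing Implicit Defensive.

(** Write n = p - 1.  If gcd(h, n) = e, then h is an h-th power modulo p exactly
when h lies in the subgroup K of index e, the roots of x^(n/e) = 1.  Hence the
error term is the sum over e | n of the sums of 1_K(ek) - 1/e over the k <= n/e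
coprime to n/e.  Inclusion-exclusion over the primes of n/e reduces the
coprimality condition, at the cost of a factor 2^omega(n/e) <= d(n), to sums
over multiples, for which a Polya-Vinogradov bound sqrt(p) (1 + ln p) is needed.

Multiplicative characters and Gauss sums are avoided.  The function
f = 1_K - 1/e on the units is invariant under dilation by K, hence so is the
energy |f^(t)|^2 of its additive Fourier transform; by Parseval the |K| equal
values |f^(kt)|^2 add up to at most p |f|_2^2 <= p |K|, so |f^(t)|^2 <= p for all
t <> 0.  Fourier inversion and geometric sums then finish as usual, with
1/sin(pi t/p) <= (p/2) (1/t + 1/(p-t)).  Everything is kept real by using
the pair (cosine transform, sine transform) for f^. *)

(** * Sines and harmonic sums *)

(** Concavity of the sine: the mean value theorem on [0, x] and on [x, pi/2] gives slopes cos c1 and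
    cos c2 with c1 < c2, and cosine decreases there. *)
Lemma jordan_sin (R : realType) (x : R) : 0 <= x <= pi / 2 -> x <= pi / 2 * sin x.
Proof.
have pi0 := pi_gt0 R.
move=> /andP[x0 x1].
have [->|xn0] := eqVneq x 0; first by rewrite sin0 mulr0.
have {xn0}x0 : 0 < x by rewrite lt0r xn0.
have [->|xn1] := eqVneq x (pi / 2); first by rewrite sin_pihalf mulr1.
have {xn1}x1 : x < pi / 2 by rewrite lt_neqAle xn1.
have dsin (a b : R) : ({within `[a, b], continuous (@sin R)})%classic.
  by apply: continuous_subspaceT => z; exact: continuous_sin.
have [c1 /[!in_itv]/= /andP[c10 c11]] := MVT x0 (fun z _ => is_derive_sin z) (dsin _ _).
have [c2 /[!in_itv]/= /andP[c20 c21]] := MVT x1 (fun z _ => is_derive_sin z) (dsin _ _).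
rewrite sin0 sin_pihalf !subr0 => h2 h1.
have : cos c2 <= cos c1.
  by apply/ltW; rewrite ltr_cos ?in_itv/= ?(lt_trans c11)//; apply/andP; split; lra.
move=> h; rewrite -subr_ge0.
have -> : pi / 2 * sin x - x = (pi / 2 - x) * sin x - x * (1 - sin x) by ring.
rewrite h2 h1.
have -> : (pi / 2 - x) * (cos c1 * x) - x * (cos c2 * (pi / 2 - x))
    = (pi / 2 - x) * x * (cos c1 - cos c2) by ring.
by rewrite !mulr_ge0// ?subr_ge0// ltW.
Qed.

(** For t <= p/2 Jordan's inequality gives the first term alone; the symmetry t -> p - t gives the
    second otherwise. Keeping both terms makes the bound uniform in t, ready for summation. *)
Lemma cscr_le (R : realType) (p t : nat) : (0 < t < p)%N ->
  (sin (pi * t%:R / p%:R))^-1 <= p%:R / 2 * (t%:R^-1 + (p - t)%:R^-1) :> R.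
Proof.
have pi0 := pi_gt0 R.
have half (s : nat) : (0 < s)%N -> (s.*2 <= p)%N ->
    (sin (pi * s%:R / p%:R))^-1 <= p%:R / 2 * s%:R^-1 :> R.
  move=> s0 sp.
  have p0 : (0 : R) < p%:R by rewrite ltr0n; lia.
  have s0' : (0 : R) < s%:R by rewrite ltr0n.
  have sp' : s%:R * 2 <= p%:R :> R by rewrite -natrM ler_nat; lia.
  have le1 : s%:R / p%:R <= 1 / 2 :> R by rewrite ler_pdivrMr//; lra.
  have gt0 : 0 < s%:R / p%:R :> R by rewrite divr_gt0.
  rewrite -mulrA; set u := s%:R / p%:R in le1 gt0 *.
  have h : pi * u <= pi / 2 * sin (pi * u).
    by apply: jordan_sin; apply/andP; split; nra.
  have h2 : 2 * u <= sin (pi * u) by rewrite -(ler_pM2l pi0); lra.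
  have -> : p%:R / 2 * s%:R^-1 = (2 * u)^-1 by rewrite /u; field; rewrite !gt_eqF.
  by rewrite lef_pV2// posrE; lra.
move=> /andP[t0 tp].
have p0 : (0 : R) < p%:R by rewrite ltr0n; lia.
have v1 : (0 : R) <= p%:R / 2 * t%:R^-1 by rewrite mulr_ge0// ?divr_ge0 ?invr_ge0.
have v2 : (0 : R) <= p%:R / 2 * (p - t)%:R^-1 by rewrite mulr_ge0// ?divr_ge0 ?invr_ge0.
rewrite mulrDr.
have [h|h] := leqP t.*2 p.
  by rewrite (le_trans (half _ t0 h))// lerDl.
have -> : sin (pi * t%:R / p%:R) = sin (pi * (p - t)%:R / p%:R) :> R.
  have -> : pi * (p - t)%:R / p%:R = - (pi * t%:R / p%:R - pi) :> R.
    by rewrite (natrB _ (ltnW tp)) mulrBr mulrBl mulfK ?gt_eqF// opprB.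
  by rewrite sinN sinB cospi sinpi; ring.
by rewrite (le_trans (half _ _ _)) ?lerDr//; lia.
Qed.

Lemma harmonic_le (R : realType) (n : nat) :
  \sum_(1 <= k < n.+2) k%:R^-1 <= 1 + ln n.+1%:R :> R.
Proof.
elim: n => [|n IH]; first by rewrite big_nat1 ln1 invr1 addr0.
rewrite big_nat_recr//=.
(* This is ln (1 + x) <= x at x = -1/(n+2): the logarithm grows by at least the new term. *)
have h : ln (n.+1%:R / n.+2%:R) <= - n.+2%:R^-1 :> R.
  have -> : n.+1%:R / n.+2%:R = 1 + - n.+2%:R^-1 :> R.
    by rewrite -[n.+1%:R in LHS](addrK 1) -mulrSr mulrBl divff ?pnatr_eq0// mul1r.
  by apply: le_ln1Dx; rewrite ltrN2 invf_lt1// ltr1n.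
rewrite ln_div ?posrE ?ltr0n// in h.
apply: (le_trans (lerD IH (lexx _))); rewrite -addrA lerD2l.
by rewrite -lerBrDr -lerBlDl (le_trans h).
Qed.

Lemma sum_cscr_le (R : realType) (p : nat) : (1 < p)%N ->
  \sum_(1 <= t < p) (sin (pi * t%:R / p%:R))^-1 <= p%:R * (1 + ln p%:R) :> R.
Proof.
case: p => [|[|n]]// _.
have harm := @harmonic_le R n.
have -> : n.+2%:R * (1 + ln n.+2%:R) = n.+2%:R / 2 * ((1 + ln n.+2%:R) + (1 + ln n.+2%:R)) :> R.
  by rewrite -mulr2n -[X in _ = _ * X]mulr_natl mulrA divfK ?pnatr_eq0.
apply: (@le_trans _ _ (n.+2%:R / 2 * \sum_(1 <= t < n.+2) (t%:R^-1 + (n.+2 - t)%:R^-1))).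
  rewrite mulr_sumr; apply: ler_sum_nat => t ht; exact: cscr_le.
rewrite ler_wpM2l ?divr_ge0// big_split/= .
(* Reversing the order turns the second sum into the same harmonic sum; the two copies cancel the
   factor 1/2. *)
rewrite [X in _ + X]big_nat_rev/=.
rewrite [X in _ + X](eq_big_nat _ _ (F2 := fun k => k%:R^-1)); last first.
  move=> k hk; congr (_%:R^-1); lia.
have h : ln n.+1%:R <= ln n.+2%:R :> R by rewrite ler_ln ?posrE ?ltr0n// ler_nat.
lra.
Qed.

(** * Orthogonality of the additive characters of F_p *)

(** Multiplying by 2 sin(phi/2) makes the sum telescope, and leaving that factor on the left avoids
    assuming it nonzero. *)
Lemma sum_cos (R : realType) (phi : R) (m n : nat) : (m <= n)%N ->
  2 * sin (phi / 2) * \sum_(m <= j < n) cos (j%:R * phi)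
  = sin (n%:R * phi - phi / 2) - sin (m%:R * phi - phi / 2).
Proof.
move=> mn; rewrite mulr_sumr -(telescope_sumr (fun j : nat => sin (j%:R * phi - phi / 2)) mn).
apply: eq_bigr => j _.
have -> : j.+1%:R * phi - phi / 2 = j%:R * phi + phi / 2.
  by rewrite -addn1 natrD mulrDl mul1r -addrA {2}[phi]splitr addrK.
by rewrite sinD sinB; ring.
Qed.

Lemma sum_sin (R : realType) (phi : R) (m n : nat) : (m <= n)%N ->
  2 * sin (phi / 2) * \sum_(m <= j < n) sin (j%:R * phi)
  = cos (m%:R * phi - phi / 2) - cos (n%:R * phi - phi / 2).
Proof.
move=> mn; rewrite mulr_sumr -[RHS]opprB.
rewrite -(telescope_sumr (fun j : nat => cos (j%:R * phi - phi / 2)) mn) -sumrN.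
apply: eq_bigr => j _.
have -> : j.+1%:R * phi - phi / 2 = j%:R * phi + phi / 2.
  by rewrite -addn1 natrD mulrDl mul1r -addrA {2}[phi]splitr addrK.
by rewrite cosD cosB; ring.
Qed.

(** The telescoped ends are two points of the unit circle, so they are at distance at most 2, which
    the factor 2 sin(phi/2) absorbs. *)
Lemma geometric_bound (R : realType) (phi : R) (m n : nat) : (m <= n)%N ->
  0 < sin (phi / 2) ->
  (\sum_(m <= j < n) cos (j%:R * phi)) ^+ 2 + (\sum_(m <= j < n) sin (j%:R * phi)) ^+ 2
  <= (sin (phi / 2))^-1 ^+ 2.
Proof.
move=> mn s0; have := sum_cos phi mn; have := sum_sin phi mn.
set C := \sum_(_ <= _ < _) cos _; set S := \sum_(_ <= _ < _) sin _.
set s := sin (phi / 2) in s0 *; set a := _ - phi / 2; set b := _ - phi / 2 => hS hC.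
rewrite exprVn -[_ ^- 2]mul1r ler_pdivlMr ?exprn_gt0//.
have ha := cos2Dsin2 a; have hb := cos2Dsin2 b.
have hab := cos_geN1 (a - b); rewrite cosB in hab.
have -> : (C ^+ 2 + S ^+ 2) * s ^+ 2 = ((2 * s * C) ^+ 2 + (2 * s * S) ^+ 2) / 4 by field.
rewrite hC hS; lra.
Qed.

Definition angle (R : realType) (p k : nat) : R := pi *+ 2 / p%:R * k%:R.

Lemma angle_mod (R : realType) (p k : nat) : (0 < p)%N ->
  angle R p k = angle R p (k %% p) + (pi *+ 2) *+ (k %/ p).
Proof.
move=> p0; rewrite /angle {1}(divn_eq k p) natrD natrM mulrDr addrC; congr (_ + _).
by rewrite mulrCA divfK ?pnatr_eq0 -?lt0n// mulr_natl.
Qed.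

Lemma cos_angle_mod (R : realType) (p k : nat) : (0 < p)%N ->
  cos (angle R p (k %% p)) = cos (angle R p k).
Proof. by move=> p0; rewrite [in RHS]angle_mod// (periodicn (@cosD2pi R)). Qed.

Lemma sin_angle_mod (R : realType) (p k : nat) : (0 < p)%N ->
  sin (angle R p (k %% p)) = sin (angle R p k).
Proof. by move=> p0; rewrite [in RHS]angle_mod// (periodicn (@sinD2pi R)). Qed.

Lemma angle_half (R : realType) (p k : nat) : angle R p k / 2 = pi * k%:R / p%:R.
Proof.
rewrite /angle; have -> : pi *+ 2 / p%:R * k%:R / 2 = pi * k%:R / p%:R * (2 / 2) :> R by ring.
by rewrite divff ?mulr1.
Qed.

Lemma sin_half_angle_gt0 (R : realType) (p k : nat) : (0 < k < p)%N ->
  0 < sin (angle R p k / 2).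
Proof.
move=> /andP[k0 kp]; have pi0 := pi_gt0 R.
have p0 : (0 : R) < p%:R by rewrite ltr0n (leq_trans _ kp).
apply: sin_gt0_pi; rewrite angle_half -mulrA; apply/andP; split.
  by rewrite mulr_gt0// divr_gt0// ltr0n.
by rewrite gtr_pMr// ltr_pdivrMr// mul1r ltr_nat.
Qed.

Lemma sum_cos_angle0 (R : realType) (p d : nat) : (0 < d < p)%N ->
  \sum_(0 <= t < p) cos (t%:R * angle R p d) = 0.
Proof.
move=> dp; have s0 := sin_half_angle_gt0 R dp.
have p0 : (0 < p)%N by case/andP: dp => _; apply: leq_trans.
have := sum_cos (angle R p d) (leq0n p).
(* The p steps make d full turns, so both telescoped ends have the same sine. *)
have -> : p%:R * angle R p d - angle R p d / 2
    = 0%:R * angle R p d - angle R p d / 2 + (pi *+ 2) *+ d.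
  rewrite mul0r add0r addrC; congr (_ + _).
  by rewrite /angle mulrA mulrCA divff ?mulr1 ?mulr_natr// pnatr_eq0 -lt0n.
rewrite (periodicn (@sinD2pi R)) subrr => /eqP; rewrite mulf_eq0 => /orP[|/eqP//].
by rewrite mulf_eq0 (gt_eqF s0) orbF pnatr_eq0.
Qed.

(** Real and imaginary parts of the additive character exp(2 pi i x t / p). The product x * t is
    taken in [nat], on representatives, where [angle] is linear; periodicity accounts for reduction
    modulo p. *)
Definition fp_cos (R : realType) (p : nat) (x t : 'F_p) : R := cos (angle R p (x * t)).
Definition fp_sin (R : realType) (p : nat) (x t : 'F_p) : R := sin (angle R p (x * t)).

Lemma val_Fp_mul (p : nat) (x y : 'F_p) : prime p -> (x * y)%R = (x * y %% p)%N :> nat.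
Proof. by move=> pr; apply: (congr1 (modn _) (Fp_cast pr)). Qed.

Lemma ltn_Fp (p : nat) (x : 'F_p) : prime p -> (x < p)%N.
Proof. by move=> pr; rewrite -{2}(Fp_cast pr). Qed.

Lemma fp_cosC (R : realType) (p : nat) (x t : 'F_p) : fp_cos R x t = fp_cos R t x.
Proof. by rewrite /fp_cos mulnC. Qed.

Lemma fp_sinC (R : realType) (p : nat) (x t : 'F_p) : fp_sin R x t = fp_sin R t x.
Proof. by rewrite /fp_sin mulnC. Qed.

Lemma fp_cosM (R : realType) (p : nat) (h x t : 'F_p) : prime p ->
  fp_cos R (h * x) t = fp_cos R x (h * t).
Proof.
move=> pr; have p0 := prime_gt0 pr; rewrite /fp_cos !val_Fp_mul//.
by rewrite -cos_angle_mod// -[RHS]cos_angle_mod// modnMml modnMmr mulnCA mulnA.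
Qed.

Lemma fp_sinM (R : realType) (p : nat) (h x t : 'F_p) : prime p ->
  fp_sin R (h * x) t = fp_sin R x (h * t).
Proof.
move=> pr; have p0 := prime_gt0 pr; rewrite /fp_sin !val_Fp_mul//.
by rewrite -sin_angle_mod// -[RHS]sin_angle_mod// modnMml modnMmr mulnCA mulnA.
Qed.

Lemma sum_Fp (V : nmodType) (p : nat) (F : nat -> V) : prime p ->
  \sum_(t : 'F_p) F t = \sum_(0 <= t < p) F t.
Proof. by move=> pr; rewrite -(big_mkord xpredT F) /= Fp_cast. Qed.

Lemma fp_orthogonality (R : realType) (p : nat) (x y : 'F_p) : prime p ->
  \sum_t (fp_cos R x t * fp_cos R y t + fp_sin R x t * fp_sin R y t) = p%:R *+ (x == y).
Proof.
move=> pr.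
(* The ordering lets x - y below be a subtraction of natural numbers without truncation. *)
wlog xy : x y / (y <= x)%N.
  move=> W; have [/W//|/ltnW/W] := leqP y x.
  rewrite eq_sym => <-; apply: eq_bigr => t _; by rewrite mulrC [X in _ + X]mulrC.
have [->|xny] := eqVneq x y.
  rewrite (eq_bigr (fun=> 1)) ?sumr_const ?card_Fp// => t _.
  by rewrite -!expr2 cos2Dsin2.
rewrite (eq_bigr (fun t : 'F_p => cos ((t : nat)%:R * angle R p (x - y)))).
  rewrite (sum_Fp (fun t => cos (t%:R * angle R p (x - y)))) ?sum_cos_angle0//.
  have := ltn_Fp x pr; have : (x : nat) != y by []. lia.
move=> t _; rewrite /fp_cos /fp_sin -cosB /angle -mulrBr; congr cos.
by rewrite mulrCA -natrM -natrB ?leq_mul// mulnBr [(t * x)%N]mulnC [(t * y)%N]mulnC.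
Qed.

(** * Fourier analysis on F_p and interval sums *)

Definition cos_transform (R : realType) (p : nat) (f : 'F_p -> R) (t : 'F_p) : R :=
  \sum_x f x * fp_cos R x t.
Definition sin_transform (R : realType) (p : nat) (f : 'F_p -> R) (t : 'F_p) : R :=
  \sum_x f x * fp_sin R x t.
Definition energy (R : realType) (p : nat) (f : 'F_p -> R) (t : 'F_p) : R :=
  cos_transform f t ^+ 2 + sin_transform f t ^+ 2.

Lemma fourier_inversion (R : realType) (p : nat) (f : 'F_p -> R) (x : 'F_p) : prime p ->
  \sum_t (cos_transform f t * fp_cos R x t + sin_transform f t * fp_sin R x t) = p%:R * f x.
Proof.
move=> pr.
transitivity (\sum_t \sum_y f y * (fp_cos R y t * fp_cos R x t + fp_sin R y t * fp_sin R x t)).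
  apply: eq_bigr => t _; rewrite /cos_transform /sin_transform !mulr_suml -big_split.
  by apply: eq_bigr => y _; rewrite /= mulrDr !mulrA.
rewrite exchange_big (bigD1 x)//= [X in _ + X]big1 ?addr0.
  by rewrite -mulr_sumr fp_orthogonality// eqxx mulrC.
by move=> y /negPf yx; rewrite -mulr_sumr fp_orthogonality// yx mulr0.
Qed.

Lemma parseval (R : realType) (p : nat) (f : 'F_p -> R) : prime p ->
  \sum_t energy f t = p%:R * \sum_x f x ^+ 2.
Proof.
move=> pr; rewrite mulr_sumr.
transitivity (\sum_t \sum_x
  f x * (cos_transform f t * fp_cos R x t + sin_transform f t * fp_sin R x t)).
  (* Only one factor of each square is expanded; the other is kept for [fourier_inversion]. *)
  apply: eq_bigr => t _; rewrite /energy !expr2 {2}/cos_transform {2}/sin_transform.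
  rewrite !mulr_sumr -big_split; apply: eq_bigr => x _ /=; ring.
rewrite exchange_big; apply: eq_bigr => x _ /=.
by rewrite -mulr_sumr fourier_inversion// expr2 mulrCA.
Qed.

(** Substituting h x for x in the transform at t moves h onto the frequency and leaves f
    unchanged. *)
Lemma energy_dilation (R : realType) (p : nat) (f : 'F_p -> R) (h t : 'F_p) : prime p ->
  h != 0 -> (forall x, f (h * x) = f x) -> energy f (h * t) = energy f t.
Proof.
move=> pr h0 fh.
have bij : {on xpredT, bijective (fun x : 'F_p => h * x)}.
  by apply: onW_bij; exists (fun x => h^-1 * x) => x; rewrite ?mulKf ?mulVKf.
rewrite /energy; congr (_ ^+ 2 + _ ^+ 2).
  rewrite /cos_transform [RHS](reindex _ bij); apply: eq_bigr => x _ /=.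
  by rewrite fh fp_cosM.
rewrite /sin_transform [RHS](reindex _ bij); apply: eq_bigr => x _ /=.
by rewrite fh fp_sinM.
Qed.

Lemma energy_le (R : realType) (p : nat) (f : 'F_p -> R) (H : {set 'F_p}) (t : 'F_p) :
  prime p -> 0 \notin H -> (forall h x, h \in H -> f (h * x) = f x) -> t != 0 ->
  #|H|%:R * energy f t <= p%:R * \sum_x f x ^+ 2.
Proof.
move=> pr H0 fH t0; rewrite -parseval//.
have nn u : 0 <= energy f u by rewrite addr_ge0 ?sqr_ge0.
have inj : {in H &, injective (fun h => h * t)} by move=> x y _ _; apply: mulIf.
(* The points h t with h in H are distinct because t is nonzero, and all carry the same energy;
   their total is part of the Parseval sum. *)
have -> : #|H|%:R * energy f t = \sum_(u in [set h * t | h in H]) energy f u.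
  rewrite big_imset//= (eq_bigr (fun=> energy f t)).
    by rewrite sumr_const mulr_natl.
  move=> h hH; apply: energy_dilation => // [|x]; last exact: fH.
  by apply: contraNneq H0 => <-.
by rewrite [leRHS](bigID (mem [set h * t | h in H])) /= lerDl sumr_ge0.
Qed.

Lemma fp_cos_nat (R : realType) (p j : nat) (t : 'F_p) : prime p ->
  fp_cos R j%:R t = cos (j%:R * angle R p t).
Proof.
move=> pr; have p0 := prime_gt0 pr; rewrite /fp_cos val_Fp_nat//.
by rewrite -cos_angle_mod// modnMml cos_angle_mod// /angle mulrCA -natrM.
Qed.

Lemma fp_sin_nat (R : realType) (p j : nat) (t : 'F_p) : prime p ->
  fp_sin R j%:R t = sin (j%:R * angle R p t).
Proof.
move=> pr; have p0 := prime_gt0 pr; rewrite /fp_sin val_Fp_nat//.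
by rewrite -sin_angle_mod// modnMml sin_angle_mod// /angle mulrCA -natrM.
Qed.

(** Cauchy-Schwarz in the plane, from Lagrange's identity. The asymmetry in u and v fits its use: an
    energy bound is already a square, a cosecant is a length. *)
Lemma norm_dot2_le (R : realType) (a b c d u v : R) : 0 <= v ->
  a ^+ 2 + b ^+ 2 <= u -> c ^+ 2 + d ^+ 2 <= v ^+ 2 ->
  `|a * c + b * d| <= Num.sqrt u * v.
Proof.
move=> v0 hu hv.
have u0 : 0 <= u by apply: le_trans hu; rewrite addr_ge0 ?sqr_ge0.
rewrite -[leLHS]ger0_norm// -[leRHS]ger0_norm ?mulr_ge0 ?sqrtr_ge0//.
rewrite -ler_sqr ?nnegrE// ?normr_ge0// !real_normK ?num_real// exprMn sqr_sqrtr//.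
apply: le_trans (ler_pM _ _ hu hv); rewrite ?addr_ge0 ?sqr_ge0//.
have -> : (a ^+ 2 + b ^+ 2) * (c ^+ 2 + d ^+ 2)
    = (a * c + b * d) ^+ 2 + (a * d - b * c) ^+ 2 by ring.
by rewrite lerDl sqr_ge0.
Qed.

Lemma polya_vinogradov (R : realType) (p : nat) (f : 'F_p -> R) (m n : nat) : prime p ->
  (m <= n)%N -> \sum_x f x = 0 -> (forall t, t != 0 -> energy f t <= p%:R) ->
  `|\sum_(m <= j < n) f j%:R| <= Num.sqrt p%:R * (1 + ln p%:R).
Proof.
move=> pr mn f0 fE.
have p0 : (0 : R) < p%:R by rewrite ltr0n prime_gt0.
rewrite -(ler_pM2l p0) -[X in X * `|_|]gtr0_norm// -normrM mulr_sumr.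
under eq_bigr do rewrite -fourier_inversion//.
rewrite exchange_big/=.
(* Majorant of the contribution of each frequency. Frequency 0 contributes nothing because f has sum
   zero. *)
pose G (t : nat) : R := if t == 0%N then 0 else Num.sqrt p%:R * (sin (pi * t%:R / p%:R))^-1.
apply: (@le_trans _ _ (\sum_(t : 'F_p) G t)).
  apply: le_trans (ler_norm_sum _ _ _) _; apply: ler_sum => t _.
  rewrite big_split/= -!mulr_sumr /G.
  have [t0|t0] := eqVneq (t : nat) 0%N.
    rewrite /cos_transform /sin_transform.
    under eq_bigr do rewrite /fp_cos t0 muln0 /angle mulr0 cos0 mulr1.
    rewrite f0 mul0r add0r.
    under eq_bigr do rewrite /fp_sin t0 muln0 /angle mulr0 sin0 mulr0.
    by rewrite big1// mul0r normr0.
  have tp : (0 < t < p)%N by rewrite lt0n t0 ltn_Fp.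
  have s0 := sin_half_angle_gt0 R tp.
  rewrite -angle_half; apply: norm_dot2_le.
  - by rewrite invr_ge0 ltW.
  - by apply: fE; apply: contraNneq t0 => ->.
  under eq_bigr do rewrite fp_cos_nat//.
  under [X in _ + X ^+ 2]eq_bigr do rewrite fp_sin_nat//.
  exact: geometric_bound.
rewrite sum_Fp// big_ltn ?prime_gt0// {1}/G eqxx add0r.
rewrite mulrCA; apply: le_trans (ler_wpM2l (sqrtr_ge0 _) (sum_cscr_le R (prime_gt1 pr))).
rewrite mulr_sumr le_eqVlt; apply/orP; left; apply/eqP.
by apply: eq_big_nat => t /andP[t0 _]; rewrite /G gtn_eqF.
Qed.

Lemma subgroup_count_interval (R : realType) (p e : nat) (H : {set 'F_p}) (a : 'F_p) (n : nat) :
  prime p -> (#|H| * e = p.-1)%N -> 0 \notin H ->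
  (forall h x, h \in H -> (h * x \in H) = (x \in H)) -> a != 0 -> (n < p)%N ->
  `|\sum_(1 <= j < n.+1) ((a * j%:R \in H)%:R - e%:R^-1)| <= Num.sqrt p%:R * (1 + ln p%:R) :> R.
Proof.
move=> pr He H0 HM a0 np.
have p1 := prime_gt1 pr.
have [H_gt0 e_gt0] : (0 < #|H|)%N /\ (0 < e)%N.
  by apply/andP; rewrite -muln_gt0 He; lia.
have e0 : e%:R != 0 :> R by rewrite pnatr_eq0 -lt0n.
(* The mean 1/e is subtracted on the units only, so that f vanishes at 0 and has sum |H| - (p - 1)/e
   = 0. *)
pose f (x : 'F_p) : R := (a * x \in H)%:R - (x != 0)%:R / e%:R.
have sumH : \sum_(x : 'F_p) (a * x \in H)%:R = #|H|%:R :> R.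
  rewrite (reindex_onto (fun x => a^-1 * x) (fun x => a * x)) => [|x _]; last exact: mulKf.
  rewrite (eq_bigr (fun x : 'F_p => (x \in H)%:R)) => [|x _]; last by rewrite mulVKf.
  rewrite (eq_bigl xpredT) => [|x]; last by rewrite /= mulVKf ?eqxx.
  by rewrite -natr_sum -sum1_card [in RHS]big_mkcond.
have sumU : \sum_(x : 'F_p) (x != 0)%:R = #|H|%:R * e%:R :> R.
  rewrite -natrM He -natr_sum; congr (_%:R).
  have <- : #|predC1 (0 : 'F_p)| = p.-1 by rewrite cardC1 card_Fp.
  by rewrite -sum1_card [RHS]big_mkcond.
have f0 : \sum_x f x = 0.
  by rewrite sumrB -mulr_suml sumH sumU mulfK// subrr.
have f2 : \sum_x f x ^+ 2 <= #|H|%:R.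
  (* Expansion of the square, using that indicators are idempotent; the total is |H| - |H|/e. *)
  rewrite (eq_bigr (fun x => (a * x \in H)%:R * (1 - 2 / e%:R) + (x != 0)%:R / e%:R ^+ 2)).
    rewrite big_split/= -!mulr_suml sumH sumU.
    have -> : #|H|%:R * (1 - 2 / e%:R) + #|H|%:R * e%:R / e%:R ^+ 2 = #|H|%:R - #|H|%:R / e%:R :> R.
      by field.
    by rewrite gerBl divr_ge0.
  move=> x _; rewrite /f; have [->|x0] := eqVneq x 0.
    by rewrite mulr0 (negPf H0) /= !mul0r subr0 expr0n addr0.
  by case: (_ \in H) => /=; field.
have fE t : t != 0 -> energy f t <= p%:R.
  move=> t0; rewrite -(@ler_pM2l _ #|H|%:R) ?ltr0n// [leRHS]mulrC.
  apply: le_trans (energy_le (f := f) pr H0 _ t0) _; last by rewrite ler_wpM2l.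
  move=> h x hH; rewrite /f mulrCA HM// mulf_eq0.
  by rewrite (_ : h == 0 = false)//; apply: contraNF H0 => /eqP <-.
rewrite (eq_big_nat _ _ (F2 := fun j => f j%:R)); first exact: polya_vinogradov.
(* Since 1 <= j <= n < p, no j of the interval vanishes in F_p, and f(j) is the summand. *)
move=> j jn; rewrite /f (_ : j%:R != 0 :> 'F_p) ?mul1r//.
rewrite -val_eqE /= val_Fp_nat// modn_small; lia.
Qed.

(** * Sieving by the primes of m *)

Lemma sum_multiples (V : nmodType) (d m : nat) (F : nat -> V) : (0 < d)%N ->
  \sum_(1 <= k < (d * m).+1 | (d %| k)%N) F k = \sum_(1 <= j < m.+1) F (d * j)%N.
Proof.
move=> d0; rewrite -big_filter -[RHS](big_map (muln d) xpredT F); apply: perm_big.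
apply: uniq_perm => [||k]; first by rewrite filter_uniq ?iota_uniq.
  by rewrite map_inj_uniq ?iota_uniq// => x y /eqP; rewrite eqn_pmul2l// => /eqP.
rewrite mem_filter mem_index_iota; apply/idP/mapP.
  move=> /andP[/dvdnP[j ->]] /[!ltnS] /andP[jd]; rewrite mulnC leq_pmul2l// => jm.
  by exists j => //; rewrite mem_index_iota; lia.
case=> j; rewrite mem_index_iota => jm ->.
by rewrite dvdn_mulr// muln_gt0 d0 ltnS leq_pmul2l//; lia.
Qed.

(* The parameter d makes the induction on ps go through: it collects the primes
   q whose multiples have been subtracted. *)
Lemma sieve_bound (R : realDomainType) (m : nat) (F : nat -> R) (b : R) (ps : seq nat) (d : nat) :
  (forall c, (c %| m)%N -> `|\sum_(1 <= k < m.+1 | (c %| k)%N) F k| <= b) ->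
  all prime ps -> uniq ps -> all (coprime d) ps -> (d * \prod_(q <- ps) q %| m)%N ->
  `|\sum_(1 <= k < m.+1 | (d %| k)%N && all (fun q => ~~ (q %| k)%N) ps) F k|
  <= (2 ^ size ps)%:R * b.
Proof.
move=> hb; elim: ps d => [|q ps IH] d /=.
  move=> _ _ _; rewrite big_nil muln1 mul1r => dm.
  by under eq_bigl do rewrite andbT; exact: hb.
move=> /andP[pq pps] /andP[qps ups] /andP[dq dps]; rewrite big_cons mulnA => dm.
have cq : all (coprime q) ps.
  apply/allP => r rps; rewrite prime_coprime// (dvdn_prime2 pq (allP pps _ rps)).
  by apply: contraNN qps => /eqP->.
have h1 := IH d pps ups dps (dvdn_trans _ dm).
have h2 := IH (d * q)%N pps ups _ dm.
(* Drop the condition at q, then subtract the multiples of q; as d and q are coprime, these are the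
   multiples of d q. Each new prime thus doubles the bound. *)
have -> : \sum_(1 <= k < m.+1 | (d %| k)%N && all (fun r => ~~ (r %| k)%N) (q :: ps)) F k
  = \sum_(1 <= k < m.+1 | (d %| k)%N && all (fun r => ~~ (r %| k)%N) ps) F k
  - \sum_(1 <= k < m.+1 | (d * q %| k)%N && all (fun r => ~~ (r %| k)%N) ps) F k.
  rewrite [X in _ = X - _](bigID (fun k => q %| k)%N) /=.
  rewrite [X in _ = X + _ - _](eq_bigl (fun k =>
    (d * q %| k)%N && all (fun r => ~~ (r %| k)%N) ps)).
    by rewrite [X in _ = X - _]addrC addrK; apply: eq_bigl => k /=; rewrite andbA andbAC.
  by move=> k; rewrite Gauss_dvd// andbAC.
apply: le_trans (ler_normB _ _) _.
rewrite expnS mul2n -addnn natrD mulrDl lerD//.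
  by apply: h1; rewrite dvdn_mul// dvdn_mulr.
by apply: h2; apply/allP => r rps; rewrite coprimeMl (allP dps)// (allP cq).
Qed.

(** The divisors of m and their multiples by q are two disjoint families of divisors of q m. *)
Lemma ndiv_mul_prime (q m : nat) : prime q -> (0 < m)%N -> ~~ (q %| m)%N ->
  (2 * ndiv m <= ndiv (q * m))%N.
Proof.
move=> pq m0 qm; have q0 := prime_gt0 pq; rewrite /ndiv mul2n -addnn.
rewrite -{2}(size_map (muln q) (divisors m)) -size_cat.
apply: uniq_leq_size.
  rewrite cat_uniq divisors_uniq map_inj_uniq ?divisors_uniq ?andbT/=; last first.
    by move=> x y /eqP; rewrite eqn_pmul2l// => /eqP.
  apply/hasPn => _ /mapP[d _ ->]; rewrite -dvdn_divisors//.
  by apply: contra qm; apply: dvdn_trans; rewrite dvdn_mulr.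
move=> d; rewrite mem_cat -!dvdn_divisors ?muln_gt0 ?q0// => /orP[dm|/mapP[c]].
  by rewrite dvdn_mull.
by rewrite -dvdn_divisors// => cm ->; rewrite dvdn_pmul2l.
Qed.

Lemma leq_ndiv_dvd (m n : nat) : (0 < n)%N -> (m %| n)%N -> (ndiv m <= ndiv n)%N.
Proof.
move=> n0 mn; have m0 := dvdn_gt0 n0 mn.
apply: uniq_leq_size (divisors_uniq m) _ => d.
by rewrite -!dvdn_divisors// => /dvdn_trans; apply.
Qed.

Lemma coprime_prod_primes (q : nat) (ps : seq nat) : prime q -> all prime ps -> q \notin ps ->
  coprime q (\prod_(r <- ps) r).
Proof.
move=> pq; elim: ps => [|r ps IH]; first by rewrite big_nil coprimen1.
move=> /andP[pr pps]; rewrite inE negb_or => /andP[qr qps].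
by rewrite big_cons coprimeMr IH// prime_coprime// dvdn_prime2// qr.
Qed.

Lemma exp2_le_ndiv_prod (ps : seq nat) : all prime ps -> uniq ps ->
  (2 ^ size ps <= ndiv (\prod_(q <- ps) q))%N.
Proof.
elim: ps => [|q ps IH] /=; first by rewrite big_nil.
move=> /andP[pq pps] /andP[qps ups]; rewrite big_cons expnS.
have P0 : (0 < \prod_(r <- ps) r)%N.
  by rewrite big_seq prodn_cond_gt0// => r /(allP pps)/prime_gt0.
apply: leq_trans (ndiv_mul_prime pq P0 _); first by rewrite leq_mul2l IH.
by rewrite -prime_coprime// coprime_prod_primes.
Qed.

Lemma prod_primes_dvd (m : nat) (ps : seq nat) : all prime ps -> uniq ps ->
  all (dvdn^~ m) ps -> (\prod_(q <- ps) q %| m)%N.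
Proof.
elim: ps => [|q ps IH] /=; first by rewrite big_nil dvd1n.
move=> /andP[pq pps] /andP[qps ups] /andP[qm psm]; rewrite big_cons.
by rewrite Gauss_dvd ?coprime_prod_primes// qm IH.
Qed.

(** The sieve starts at d = 1 with all primes of m. Its factor 2^omega(m) is at most the number of
    divisors of the radical of m, hence of m. *)
Lemma coprime_sum_bound (R : realDomainType) (m : nat) (F : nat -> R) (b : R) :
  (0 < m)%N -> 0 <= b ->
  (forall c, (c %| m)%N -> `|\sum_(1 <= k < m.+1 | (c %| k)%N) F k| <= b) ->
  `|\sum_(1 <= k < m.+1 | coprime k m) F k| <= (ndiv m)%:R * b.
Proof.
move=> m0 b0 hb.
have pps : all prime (primes m) by apply/allP => q; rewrite mem_primes => /and3P[].
have psm : all (dvdn^~ m) (primes m) by apply/allP => q; rewrite mem_primes => /and3P[].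
have Pm := prod_primes_dvd pps (primes_uniq m) psm.
apply: (@le_trans _ _ ((2 ^ size (primes m))%:R * b)); last first.
  rewrite ler_wpM2r// ler_nat.
  exact: leq_trans (exp2_le_ndiv_prod pps (primes_uniq m)) (leq_ndiv_dvd m0 Pm).
have E k : (1 <= k < m.+1)%N && coprime k m
    = (1 <= k < m.+1)%N && ((1 %| k)%N && all (fun q => ~~ (q %| k)%N) (primes m)).
  case: (boolP (1 <= k < m.+1)%N) => //= /andP[k0 _]; rewrite dvd1n/=.
  rewrite coprime_has_primes// -all_predC; apply: eq_in_all => q /=.
  by rewrite !mem_primes => /and3P[-> _ _]; rewrite k0.
rewrite big_nat_cond (eq_bigl _ _ E) -big_nat_cond.
apply: sieve_bound => //; first exact: primes_uniq.
  by apply/allP => q _; rewrite coprime1n.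
by rewrite mul1n.
Qed.

(** * Power residues modulo p *)

Lemma expf_Fp (p : nat) (x : 'F_p) : prime p -> x != 0 -> x ^+ p.-1 = 1.
Proof.
move=> pr x0; apply: (mulfI x0).
by rewrite -exprS prednK ?prime_gt0// mulr1 -{2}(expf_card x) card_Fp.
Qed.

Lemma Fp_prim_root (p : nat) : prime p -> exists w : 'F_p, p.-1.-primitive_root w.
Proof.
move=> pr; have n0 : (0 < p.-1)%N by have := prime_gt1 pr; lia.
have : has p.-1.-primitive_root (enum (predC1 (0 : 'F_p))).
  apply: has_prim_root => //; last first.
  - by rewrite -cardE cardC1 card_Fp.
  - exact: enum_uniq.
  apply/allP => x; rewrite mem_enum inE => x0.
  by rewrite unity_rootE expf_Fp.
by case/hasP => w _ hw; exists w.
Qed.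

Lemma card_unity_roots (F : finFieldType) (n : nat) (w : F) : n.-primitive_root w ->
  #|[set x : F | x ^+ n == 1]| = n.
Proof.
move=> hw.
have -> : [set x : F | x ^+ n == 1] = [set w ^+ i | i : 'I_n].
  apply/setP => x; rewrite inE; apply/eqP/imsetP => [/(prim_rootP hw)[i ->]|[i _ ->]].
    by exists i.
  by rewrite exprAC (prim_expr_order hw) expr1n.
rewrite card_imset ?card_ord// => i j /eqP; rewrite (eq_prim_root_expr hw).
by rewrite !modn_small// => /eqP/val_inj.
Qed.

(** The h-th powers of the n-th roots of unity are the powers of w^h, which is a primitive root of
    order n / gcd(h, n). *)
Lemma power_residueP (F : fieldType) (n h : nat) (w y : F) : n.-primitive_root w ->
  reflect (exists2 x, x ^+ n = 1 & x ^+ h = y) (y ^+ (n %/ gcdn h n) == 1).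
Proof.
move=> hw; apply: (iffP eqP) => [hy|[x xn <-]].
  have [i ->] := prim_rootP (exp_prim_root hw h) hy.
  exists (w ^+ i); last by rewrite exprAC.
  by rewrite exprAC (prim_expr_order hw) expr1n.
rewrite -exprM muln_divA ?dvdn_gcdr// mulnC -muln_divA ?dvdn_gcdl//.
by rewrite exprM xn expr1n.
Qed.

Lemma eqn_mod_Fp (p a b : nat) : prime p -> (a == b %[mod p])%N = (a%:R == b%:R :> 'F_p).
Proof. by move=> pr; rewrite -val_eqE /= !val_Fp_nat. Qed.

Lemma exists_root_mod (p : nat) (h : 'I_p) : prime p -> (0 < h)%N ->
  [exists g : 'I_p, (0 < g)%N && (g ^ h == h %[mod p])%N]
  = (((h : nat)%:R : 'F_p) ^+ (p.-1 %/ gcdn h p.-1) == 1).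
Proof.
move=> pr h0; have [w hw] := Fp_prim_root pr.
have hn0 : (h : nat)%:R != 0 :> 'F_p.
  by rewrite -val_eqE /= val_Fp_nat// modn_small// -lt0n.
apply/existsP/(power_residueP _ _ hw) => [[g /andP[g0]]|[x _ xh]].
  rewrite eqn_mod_Fp// natrX => /eqP gh; exists (g : nat)%:R => //.
  apply: expf_Fp => //.
  by rewrite -val_eqE /= val_Fp_nat// modn_small// -lt0n.
(* The witness g is the representative of x. It is positive, since x = 0 would force h = 0 in
   F_p. *)
exists (Ordinal (ltn_Fp x pr)); rewrite eqn_mod_Fp// natrX natr_Zp xh eqxx andbT /= lt0n.
apply: contraNneq hn0 => x0; rewrite -xh (_ : x = 0) ?expr0n; last exact: val_inj.
by rewrite gtn_eqF.
Qed.

(** * Splitting the count by gcd(h, p - 1) *)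

Lemma sum_gcd_class (V : nmodType) (e m : nat) (F : nat -> V) : (0 < e)%N ->
  \sum_(1 <= h < (e * m).+1 | gcdn h (e * m) == e) F h
  = \sum_(1 <= k < m.+1 | coprime k m) F (e * k)%N.
Proof.
move=> e0.
rewrite (eq_bigl (fun h => (e %| h)%N && (gcdn h (e * m) == e))); last first.
  move=> h; case: eqP => [<-|_]; last by rewrite andbF.
  by rewrite dvdn_gcdl.
rewrite big_mkcondr sum_multiples// [RHS]big_mkcond; apply: eq_bigr => k _.
by rewrite -muln_gcdr -{2}(muln1 e) eqn_pmul2l.
Qed.

Lemma G_any_anyE (p : nat) : prime p ->
  G_any_any p = (\sum_(e <- divisors p.-1) \sum_(1 <= k < (p.-1 %/ e).+1 | coprime k (p.-1 %/ e))
    ((e * k)%N%:R ^+ (p.-1 %/ e)%N == 1 :> 'F_p)%R)%N.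
Proof.
move=> pr; have p1 := prime_gt1 pr; have n0 : (0 < p.-1)%N by lia.
pose r e h := ((h%:R : 'F_p) ^+ (p.-1 %/ e) == 1).
transitivity (\sum_(1 <= h < p.-1.+1) r (gcdn h p.-1) h)%N.
  rewrite /G_any_any -sum1_card big_mkcond/=.
  rewrite (eq_bigr (fun h : 'I_p => (0 < h)%N && r (gcdn h p.-1) h : nat)).
    rewrite -(big_mkord xpredT (fun h => (0 < h)%N && r (gcdn h p.-1) h : nat)).
    rewrite (big_ltn (prime_gt0 pr)) /= add0n (prednK (prime_gt0 pr)).
    by apply: eq_big_nat => h /andP[-> _].
  move=> h _; rewrite inE; have [h0|//] := ltnP 0 h.
  by rewrite /= exists_root_mod.
(* The inner sum has the single term e = gcd(h, p - 1); it is inserted so that the sums can be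
   exchanged. *)
transitivity (\sum_(1 <= h < p.-1.+1) \sum_(e <- divisors p.-1 | gcdn h p.-1 == e) r e h)%N.
  apply: eq_bigr => h _; rewrite -big_filter.
  have -> : [seq e <- divisors p.-1 | gcdn h p.-1 == e] = [:: gcdn h p.-1].
    rewrite (eq_filter (a2 := pred1 (gcdn h p.-1))) => [|e]; last exact: eq_sym.
    by rewrite filter_pred1_uniq ?divisors_uniq// -dvdn_divisors// dvdn_gcdr.
  by rewrite big_seq1.
rewrite (exchange_big_dep xpredT)//= big_seq [RHS]big_seq; apply: eq_bigr => e.
rewrite -dvdn_divisors// => en.
have e0 : (0 < e)%N := dvdn_gt0 n0 en.
have := @sum_gcd_class nat e (p.-1 %/ e) (fun h => r e h : nat) e0.
by rewrite mulnC divnK.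
Qed.

Lemma totient_sum (m : nat) : (0 < m)%N ->
  totient m = (\sum_(1 <= k < m.+1 | coprime k m) 1)%N.
Proof.
(* The library sum runs over 0 <= k < m, this one over 1 <= k <= m; the ends 0 and m have the same
   gcd with m. *)
move=> m0; rewrite totient_count_coprime [RHS]big_mkcond big_ltn// big_nat_recr//= addnC.
rewrite /coprime gcdn0 gcdnn; congr (_ + _)%N.
by apply: eq_bigr => k _; rewrite gcdnC; case: (_ == _).
Qed.

(** After sieving, k = c j with c dividing m = (p - 1)/e, and the test becomes membership of (e c) j
    in the group of m-th roots of unity, of index e. The interval bound then applies with multiplier
    a = e c. *)
Lemma divisor_class_bound (R : realType) (p e : nat) : prime p -> (e %| p.-1)%N ->
  `| \sum_(1 <= k < (p.-1 %/ e).+1 | coprime k (p.-1 %/ e))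
       (((e * k)%:R ^+ (p.-1 %/ e) == 1 :> 'F_p)%:R - e%:R^-1) |
  <= (ndiv p.-1)%:R * (Num.sqrt p%:R * (1 + ln p%:R)) :> R.
Proof.
move=> pr en; have p1 := prime_gt1 pr; have n0 : (0 < p.-1)%N by lia.
have e0 : (0 < e)%N := dvdn_gt0 n0 en.
set m := (p.-1 %/ e)%N; have nE : p.-1 = (e * m)%N by rewrite mulnC divnK.
have m0 : (0 < m)%N by rewrite divn_gt0// dvdn_leq.
have B0 : 0 <= Num.sqrt p%:R * (1 + ln p%:R) :> R.
  by rewrite mulr_ge0 ?sqrtr_ge0// addr_ge0// ln_ge0// ler1n ltnW.
apply: (@le_trans _ _ ((ndiv m)%:R * (Num.sqrt p%:R * (1 + ln p%:R)))); last first.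
  by rewrite ler_wpM2r// ler_nat leq_ndiv_dvd// nE dvdn_mull.
apply: coprime_sum_bound => // c cm.
have c0 : (0 < c)%N := dvdn_gt0 m0 cm.
have mE : m = (c * (m %/ c))%N by rewrite mulnC divnK.
rewrite {1}mE sum_multiples//.
have [w hw] := Fp_prim_root pr.
pose H : {set 'F_p} := [set x | x ^+ m == 1].
have wm : m.-primitive_root (w ^+ (p.-1 %/ m)).
  by apply: dvdn_prim_root => //; rewrite nE dvdn_mull.
(* From c <= m follows 0 < e c <= e m = p - 1. *)
have ec : (e * c)%:R != 0 :> 'F_p.
  rewrite -val_eqE /= val_Fp_nat// modn_small ?muln_eq0; first by lia.
  by rewrite (@leq_ltn_trans p.-1) ?prednK ?prime_gt0// dvdn_leq// nE dvdn_pmul2l.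
rewrite (eq_bigr (fun j => ((e * c)%:R * j%:R \in H)%:R - e%:R^-1)).
  apply: subgroup_count_interval => //.
  - by rewrite (card_unity_roots wm) nE mulnC.
  - by rewrite inE expr0n gtn_eqF// eq_sym oner_eq0.
  - by move=> h x; rewrite !inE exprMn => /eqP->; rewrite mul1r.
  - rewrite (@leq_ltn_trans p.-1) ?prednK ?prime_gt0//.
    by rewrite (leq_trans (leq_div _ _))// leq_div.
by move=> j _; rewrite inE -natrM mulnA.
Qed.

Unset Implicit Arguments.

Theorem mainTheorem4 (R : realType) (p : nat) :
  prime p -> odd p ->
  `| (G_any_any p)%:R
     - \sum_(e <- divisors p.-1) (e%:R^-1 * (totient (p.-1 %/ e))%:R) : R |
  <= ((ndiv p.-1) ^ 2)%:R * Num.sqrt (p%:R) * (1 + ln (p%:R)).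
Proof.
move=> pr _; have p1 := prime_gt1 pr; have n0 : (0 < p.-1)%N by lia.
rewrite G_any_anyE// natr_sum -sumrB.
apply: le_trans (ler_norm_sum _ _ _) _.
set b := _ * (1 + ln _).
(* One factor d(p-1) counts the classes e, the other is the cost of the sieve in each class. *)
have -> : b = \sum_(e <- divisors p.-1) (ndiv p.-1)%:R * (Num.sqrt p%:R * (1 + ln p%:R)).
  by rewrite big_const_seq count_predT iter_addr_0 -[RHS]mulr_natl /b natrX expr2 !mulrA.
rewrite big_seq [leRHS]big_seq; apply: ler_sum => e; rewrite -dvdn_divisors// => en.
have m0 : (0 < p.-1 %/ e)%N by rewrite divn_gt0 ?(dvdn_gt0 n0 en)// dvdn_leq.
have h := divisor_class_bound R pr en.
(* Summing the constant 1/e over the k coprime to (p - 1)/e produces the totient term. *)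
rewrite sumrB in h.
rewrite natr_sum (totient_sum m0) natr_sum mulr_sumr.
by under [X in _ - X]eq_bigr do rewrite mulr1.
Qed.
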